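(* Let $E\subset\mathbb{H}^n$ be a closed set with boundary $S$. Take $p\notin E$ and $q\in S$ such that $\delta_E(p)=d(p,q)$, and consider a minimizing geodesic $\gamma:[0,\delta_E(p)]\to\mathbb{H}^n$, parameterized by arc-length, with $\gamma(0)=q$ and $\gamma(\delta_E(p))=p$. Assume that $S$ is $\mathbb{H}$-regular near $q$. Then $\dot\gamma(0)=\nu_q$, where $\nu_q$ is the outer horizontal unit normal to $S$ at $q$.
   Context: $\mathbb{H}^n$ is $\mathbb{R}^{2n+1}$ with coordinates $(x_1,y_1,\ldots,x_n,y_n,t)$, with the left-invariant vector fields $X_i=\partial_{x_i}+y_i\partial_t$, $Y_i=\partial_{y_i}-x_i\partial_t$ ($1\le i\le n$), $T=\partial_t$, and $n\ge 1$. The horizontal distribution $\mathcal{H}$ is spanned by the $X_i,Y_i$; $\langle\cdot,\cdot\rangle$ is the Riemannian metric making $\{X_i,Y_i,T\}$ orthonormal. $d$ is the Carnot-Carathéodory distance (infimum of Riemannian lengths of piecewise smooth curves tangent to $\mathcal{H}$); a minimizing geodesic is a curve $\gamma$ with $d(\gamma(s),\gamma(s'))=|s-s'|$ (in $\mathbb{H}^n$ these are smooth and horizontal). $\delta_E(p)=\inf\{d(p,q):q\in E\}$. A function is of class $C^1_{\mathbb{H}}$ on an open set if it is continuous with continuous horizontal derivatives $X_if,Y_if$; its horizontal gradient is $\nabla_{\mathbb{H}}f=\sum_i(X_if)X_i+(Y_if)Y_i$. $S=\partial E$ is $\mathbb{H}$-regular (of class $C^1_{\mathbb{H}}$) near $q$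 if there are an open ball $B(q,r)$ and $f\in C^1_{\mathbb{H}}(B(q,r))$ with non-vanishing horizontal gradient such that $E\cap B(q,r)=\{f\le 0\}$ and $S\cap B(q,r)=\{f=0\}$; the outer horizontal unit normal is then $\nu_q=(\nabla_{\mathbb{H}}f)_q/|(\nabla_{\mathbb{H}}f)_q|$. *)

(* Defs.v *)
From mathcomp Require Import all_boot all_order all_algebra.
From mathcomp Require Import all_classical all_reals all_analysis.
Set Implicit Arguments.
Unset Strict Implicit.
Unset Printing Implicit Defensive.
Import Order.TTheory GRing.Theory Num.Theory.
Import numFieldNormedType.Exports.
Local Open Scope classical_set_scope.
Local Open Scope ring_scope.

(* R^{2n+1} with the coordinates grouped as ((x, y), t); it carries the
   product (i.e. Euclidean) topology.  Tangent vectors at any point are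
   identified with elements of the same space via the coordinate frame
   (d/dx, d/dy, d/dt). *)
Notation heis R n := ('rV[R]_n * 'rV[R]_n * R)%type.

Section Heisenberg.
Context {R : realType} {n : nat}.
Implicit Types (p q u v : heis R n) (E : set (heis R n)).
Implicit Types (f : heis R n -> R) (c g : R -> heis R n).

Definition xc p (i : 'I_n) : R := p.1.1 0 i.
Definition yc p (i : 'I_n) : R := p.1.2 0 i.
Definition tc p : R := p.2.

Definition X_ (i : 'I_n) p : heis R n := ((delta_mx 0 i, 0), yc p i).
Definition Y_ (i : 'I_n) p : heis R n := ((0, delta_mx 0 i), - xc p i).
Definition T_ p : heis R n := ((0, 0), 1).

Definition horizontal p v : Prop :=
  exists a b : 'I_n -> R, v = \sum_(i < n) (a i *: X_ i p + b i *: Y_ i p).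

(* The T-component of v in the frame X, Y, T at p; its X_i- and Y_i-components
   are xc v i and yc v i, since d/dx_i = X_i - y_i T and d/dy_i = Y_i + x_i T. *)
Definition vertical_part p v : R :=
  tc v - \sum_(i < n) (xc v i * yc p i - yc v i * xc p i).

Definition metric p u v : R :=
  \sum_(i < n) (xc u i * xc v i + yc u i * yc v i) +
  vertical_part p u * vertical_part p v.

Lemma metric_orthonormal p :
  [/\ forall i j, metric p (X_ i p) (X_ j p) = (i == j)%:R,
      forall i j, metric p (Y_ i p) (Y_ j p) = (i == j)%:R,
      forall i j, metric p (X_ i p) (Y_ j p) = 0,
      forall i, metric p (X_ i p) (T_ p) = 0 /\ metric p (Y_ i p) (T_ p) = 0 &
      metric p (T_ p) (T_ p) = 1].
Proof.
have dE i k : (delta_mx 0 i : 'rV[R]_n) 0 k = (k == i)%:R by rewrite mxE eqxx.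
have sE i (F : 'I_n -> R) : \sum_k (k == i)%:R * F k = F i.
  rewrite (bigD1 i) //= eqxx mul1r big1 ?addr0// => k /negPf ->.
  by rewrite mul0r.
have vX i : vertical_part p (X_ i p) = 0.
  rewrite /vertical_part /X_ /xc /yc /tc /=.
  rewrite (eq_bigr (fun k => (k == i)%:R * p.1.2 0 k)); last first.
    by move=> k _; rewrite dE mxE mul0r subr0.
  by rewrite sE subrr.
have vY i : vertical_part p (Y_ i p) = 0.
  rewrite /vertical_part /Y_ /xc /yc /tc /=.
  rewrite (eq_bigr (fun k => (k == i)%:R * - p.1.1 0 k)); last first.
    by move=> k _; rewrite dE mxE mul0r sub0r mulrN.
  by rewrite sE subrr.
have vT : vertical_part p (T_ p) = 1.
  rewrite /vertical_part /T_ /xc /yc /tc /= big1 ?subr0// => k _.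
  by rewrite !mxE !mul0r subr0.
split.
- move=> i j; rewrite /metric !vX mulr0 addr0 /X_ /xc /yc /=.
  rewrite (eq_bigr (fun k => (k == i)%:R * (k == j)%:R)) ?sE// => k _.
  by rewrite !dE !mxE mulr0 addr0.
- move=> i j; rewrite /metric !vY mulr0 addr0 /Y_ /xc /yc /=.
  rewrite (eq_bigr (fun k => (k == i)%:R * (k == j)%:R)) ?sE// => k _.
  by rewrite !dE !mxE mulr0 add0r.
- move=> i j; rewrite /metric vX vY mulr0 addr0 /X_ /Y_ /xc /yc /= big1//.
  by move=> k _; rewrite !mxE mulr0 mul0r addr0.
- move=> i; split; rewrite /metric ?vX ?vY mul0r addr0 /xc /yc /= big1//.
  + by move=> k _; rewrite !mxE !mulr0 addr0.
  + by move=> k _; rewrite !mxE !mulr0 addr0.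
- rewrite /metric vT mulr1 /xc /yc /= big1 ?add0r// => k _.
  by rewrite !mxE !mulr0 addr0.
Qed.

Definition tnorm p v : R := Num.sqrt (metric p v v).

Definition smooth g : Prop := forall (k : nat) (s : R), derivable (derive1n k g) s 1.

(* Smoothness on a closed subinterval is smoothness up to its endpoints: the
   restriction of c extends to a smooth map g on R, whose derivative at the
   endpoints is the one-sided derivative of c. *)
Definition piecewise_smooth_horizontal c (a b : R) : Prop :=
  exists s : seq R, [/\ path <%R a s, last a s = b &
    forall k : nat, (k < size s)%N ->
      exists g, smooth g /\
        forall z : R, nth 0 (a :: s) k <= z <= nth 0 s k ->
          c z = g z /\ horizontal (c z) (derive1 g z)].

(* derive1 c is meaningful off the finitely many subdivision points, which do not
   contribute to the integral. *)
Definition curve_length c (a b : R) : R :=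
  (\int[lebesgue_measure]_(s in `[a, b]) tnorm (c s) (derive1 c s))%R.

Definition ccdist p q : R :=
  inf [set l | exists (a b : R) c,
    [/\ a <= b, piecewise_smooth_horizontal c a b, c a = p, c b = q &
        l = curve_length c a b]].

Definition ccball q (r : R) : set (heis R n) := [set p | ccdist q p < r].

Definition set_dist E p : R := inf [set ccdist p q | q in E].

Definition minimizing_geodesic (gamma : R -> heis R n) (L : R) : Prop :=
  forall s s' : R, 0 <= s <= L -> 0 <= s' <= L ->
    ccdist (gamma s) (gamma s') = `|s - s'|.

Definition boundary E : set (heis R n) := closure E `\` interior E.

Definition Xder (i : 'I_n) f p : R := 'D_(X_ i p) f p.
Definition Yder (i : 'I_n) f p : R := 'D_(Y_ i p) f p.

Definition C1H (U : set (heis R n)) f : Prop :=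
  forall p, U p ->
    {for p, continuous f} /\
    forall i : 'I_n,
      [/\ derivable f p (X_ i p), {for p, continuous (Xder i f)},
          derivable f p (Y_ i p) & {for p, continuous (Yder i f)}].

Definition hgrad f p : heis R n :=
  \sum_(i < n) (Xder i f p *: X_ i p + Yder i f p *: Y_ i p).

(* f and r witness that the boundary of E is H-regular near q. *)
Definition H_regular_with E q (r : R) f : Prop :=
  [/\ 0 < r, C1H (ccball q r) f,
      forall p, ccball q r p -> hgrad f p != 0,
      E `&` ccball q r = [set p | f p <= 0] `&` ccball q r &
      boundary E `&` ccball q r = [set p | f p = 0] `&` ccball q r].

Definition hnormal f q : heis R n := (tnorm q (hgrad f q))^-1 *: hgrad f q.

End Heisenberg.

(* Main.v *)
Require Import Defs.
From mathcomp Require Import all_boot all_order all_algebra.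
From mathcomp Require Import all_classical all_reals all_analysis.
From mathcomp Require Import measurable_realfun ring lra.
From HB Require Import structures.
Import Order.TTheory GRing.Theory Num.Theory.
Import numFieldNormedType.Exports.
Local Open Scope classical_set_scope.
Local Open Scope ring_scope.
Set Implicit Arguments.
Unset Strict Implicit.
Unset Printing Implicit Defensive.

(** The statement is of first order at the initial point, and comes from comparing
    two estimates for the horizontal displacement of [gamma].

    For small [s > 0] the point [gamma s] is at distance [s] from [q] and
    [L - s] from [p], where [L] is the distance from [p] to [E].  From [gamma s]
    go backwards along the straight horizontal line of direction [- nu], where
    [nu] is the left-invariant unit field that equals the normal at [q], for a
    length [sigma] slightly smaller than [s].  The end point [w] is at distance
    at most [(L - s) + sigma < L] from [p], so it is outside [E] and [f w > 0].
    On the other hand [f] has a first-order expansion at [q] for the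
    Carnot-Caratheodory distance ([C1H_differentiable]): with [z] the
    horizontal part of [gamma s - q], [f w] is
    [|grad f| (<z, nu> - sigma) + o(s)].  Hence [<z, nu> >= s - o(s)].
    Since horizontal projection does not increase lengths, [|z| <= s], and so
    [|z - s nu|^2 <= 2 s^2 - 2 s <z, nu> = o(s^2)].  The vertical part of
    [gamma s - q] in the frame at [q] is [O(s^2)], because the area swept by a
    horizontal curve of length [s] is.  This gives the derivative.

    Two kinds of facts about the distance carry the argument.  Lower bounds on
    the length of a curve ([hdist_le_length], [vertical_le_length]) both come
    from [growth]: a linear form bounded by the metric on the horizontal vectors
    along a curve grows at most like its length.  Upper bounds come from straight
    lines, which are horizontal as soon as they start horizontally
    ([joins_extend]), and from polygons with sides along the [X_i] and [Y_i]
    ([connect]).  The first-order expansion follows from the mean value theorem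
    on each side of such a polygon, since the side is a line along which [f]
    has a partial derivative. *)

#[local] Arguments xc : simpl never.
#[local] Arguments yc : simpl never.
#[local] Arguments tc : simpl never.

(** * Linear algebra of the frame *)

Section Frame.
Context {R : realType} {n : nat}.
Implicit Types (p q u v w : heis R n) (a b : 'I_n -> R).

Lemma heis_eqP u v : (forall i, xc u i = xc v i) -> (forall i, yc u i = yc v i) ->
  tc u = tc v -> u = v.
Proof.
move: u v => [[x y] t] [[x' y'] t'] hx hy ht; congr (_, _, _) => //.
- by apply/rowP => i; exact: hx.
- by apply/rowP => i; exact: hy.
Qed.

Lemma xcD u v i : xc (u + v) i = xc u i + xc v i. Proof. by rewrite /xc mxE. Qed.
Lemma ycD u v i : yc (u + v) i = yc u i + yc v i. Proof. by rewrite /yc mxE. Qed.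
Lemma tcD u v : tc (u + v) = tc u + tc v. Proof. by []. Qed.
Lemma xcZ (k : R) v i : xc (k *: v) i = k * xc v i. Proof. by rewrite /xc mxE. Qed.
Lemma ycZ (k : R) v i : yc (k *: v) i = k * yc v i. Proof. by rewrite /yc mxE. Qed.
Lemma tcZ (k : R) v : tc (k *: v) = k * tc v. Proof. by []. Qed.
Definition coordE := (xcD, xcZ, ycD, ycZ, tcD, tcZ).

(** A linear functional given by its coefficients: the coordinates, the vertical
    part and the test functionals of the length estimates are all of this form,
    so that their continuity and derivatives are treated once. *)
Definition lform a b (e : R) v : R :=
  \sum_(i < n) (a i * xc v i + b i * yc v i) + e * tc v.

Lemma lform_is_linear a b e : linear_for *%R (lform a b e).
Proof.
move=> k u v; rewrite /lform [k * _]mulrDr [k * \sum_(i < n) _]mulr_sumr addrACA.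
rewrite -big_split/=; congr (_ + _).
  by apply: eq_bigr => i _; rewrite !coordE; ring.
by rewrite !coordE; ring.
Qed.
HB.instance Definition _ a b e := GRing.isLinear.Build R (heis R n) R *%R
  (lform a b e) (lform_is_linear a b e).

Lemma lformZ a b e (k : R) v : lform a b e (k *: v) = k * lform a b e v.
Proof. exact: linearZ. Qed.
Lemma lformB a b e u v : lform a b e (u - v) = lform a b e u - lform a b e v.
Proof. exact: linearB. Qed.
Lemma lformN a b e v : - lform a b e v = lform (fun i => - a i) (fun i => - b i) (- e) v.
Proof.
rewrite /lform opprD mulNr -sumrN; congr (_ + _); apply: eq_bigr => i _; ring.
Qed.

Lemma xc_continuous i : continuous (fun v : heis R n => xc v i).
Proof.
move=> v; apply: (@continuous_comp _ _ _ (fun v : heis R n => v.1.1)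
  (fun A : 'rV[R]_n => A 0 i)); last exact: coord_continuous.
by apply: (@continuous_comp _ _ _ fst fst); exact: cvg_fst.
Qed.

Lemma yc_continuous i : continuous (fun v : heis R n => yc v i).
Proof.
move=> v; apply: (@continuous_comp _ _ _ (fun v : heis R n => v.1.2)
  (fun A : 'rV[R]_n => A 0 i)); last exact: coord_continuous.
by apply: (@continuous_comp _ _ _ fst snd); [exact: cvg_fst|exact: cvg_snd].
Qed.

Lemma tc_continuous : continuous (@tc R n).
Proof. by move=> v; exact: cvg_snd. Qed.

Lemma lform_continuous a b e : continuous (lform a b e).
Proof.
move=> v; apply: cvgD.
  apply: cvg_big => [|i _]; first exact: add_continuous.
  by apply: cvgD; apply: cvgMl_tmp; [exact: xc_continuous|exact: yc_continuous].
by apply: cvgMl_tmp; exact: tc_continuous.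
Qed.

Lemma vertical_partE p : vertical_part p = lform (fun i => - yc p i) (xc p) 1.
Proof.
apply/funext => v; rewrite /vertical_part /lform mul1r addrC -sumrN; congr (_ + _).
by apply: eq_bigr => i _; ring.
Qed.

Lemma xcE i : xc^~ i = lform (fun j => (j == i)%:R) (fun=> 0) 0.
Proof.
apply/funext => v; rewrite /lform mul0r addr0 (bigD1 i)//= eqxx big1 => [|j /negPf ->].
  by rewrite mul0r !addr0 mul1r.
by rewrite !mul0r addr0.
Qed.

Lemma ycE i : yc^~ i = lform (fun=> 0) (fun j => (j == i)%:R) 0.
Proof.
apply/funext => v; rewrite /lform mul0r addr0 (bigD1 i)//= eqxx big1 => [|j /negPf ->].
  by rewrite mul0r add0r addr0 mul1r.
by rewrite !mul0r addr0.
Qed.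

Lemma tcE : @tc R n = lform (fun=> 0) (fun=> 0) 1.
Proof.
by apply/funext => v; rewrite /lform big1 ?add0r ?mul1r// => i _; rewrite !mul0r addr0.
Qed.

Definition hvec p a b : heis R n := \sum_(i < n) (a i *: X_ i p + b i *: Y_ i p).

Lemma xc_hvec p a b k : xc (hvec p a b) k = a k.
Proof.
rewrite [LHS](congr1 (@^~ _) (xcE k)) linear_sum/= (bigD1 k)//= big1 => [|i ik].
  rewrite addr0 -[LHS](congr1 (@^~ _) (xcE k)) /xc/= !mxE !eqxx /=; ring.
by rewrite -[LHS](congr1 (@^~ _) (xcE k)) /xc/= !mxE eqxx eq_sym (negPf ik)/=; ring.
Qed.

Lemma yc_hvec p a b k : yc (hvec p a b) k = b k.
Proof.
rewrite [LHS](congr1 (@^~ _) (ycE k)) linear_sum/= (bigD1 k)//= big1 => [|i ik].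
  rewrite addr0 -[LHS](congr1 (@^~ _) (ycE k)) /yc/= !mxE !eqxx /=; ring.
by rewrite -[LHS](congr1 (@^~ _) (ycE k)) /yc/= !mxE eqxx eq_sym (negPf ik)/=; ring.
Qed.

Lemma tc_hvec p a b : tc (hvec p a b) = \sum_(i < n) (a i * yc p i - b i * xc p i).
Proof.
rewrite tcE linear_sum/=; apply: eq_bigr => i _; rewrite -tcE /tc/=.
by rewrite /GRing.scale/=; ring.
Qed.

Lemma vertical_hvec p a b : vertical_part p (hvec p a b) = 0.
Proof.
rewrite /vertical_part tc_hvec; apply/eqP; rewrite subr_eq0; apply/eqP.
by apply: eq_bigr => i _; rewrite xc_hvec yc_hvec.
Qed.

Lemma vertical_horizontal p v : horizontal p v -> vertical_part p v = 0.
Proof. by move=> [a [b ->]]; exact: vertical_hvec. Qed.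

(** The coordinate components along [d/dx_i] and [d/dy_i] are also the components
    along [X_i] and [Y_i]; only the last component depends on the frame. *)
Lemma frame_decomp p v :
  v = hvec p (xc v) (yc v) + vertical_part p v *: T_ p.
Proof.
apply: heis_eqP => [i|i|].
- by rewrite {2}/xc !mxE mulr0 addr0; exact/esym/xc_hvec.
- by rewrite {2}/yc !mxE mulr0 addr0; exact/esym/yc_hvec.
- rewrite {2}/tc/=; rewrite -[X in X + _]/(tc _) tc_hvec /vertical_part.
  by rewrite /GRing.scale/= mulr1 addrC subrK.
Qed.

Definition hnorm a b : R := Num.sqrt (\sum_(i < n) (a i ^+ 2 + b i ^+ 2)).

Lemma hsum_ge0 a b : 0 <= \sum_(i < n) (a i ^+ 2 + b i ^+ 2).
Proof. by apply: sumr_ge0 => i _; rewrite addr_ge0// sqr_ge0. Qed.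

Lemma hnorm_ge0 a b : 0 <= hnorm a b. Proof. exact: sqrtr_ge0. Qed.

Lemma sqr_hnorm a b : hnorm a b ^+ 2 = \sum_(i < n) (a i ^+ 2 + b i ^+ 2).
Proof. by rewrite sqr_sqrtr// hsum_ge0. Qed.

Lemma tnorm_horizontal p v : horizontal p v -> tnorm p v = hnorm (xc v) (yc v).
Proof.
move=> /vertical_horizontal h; rewrite /tnorm /metric h mulr0 addr0.
by congr Num.sqrt; apply: eq_bigr => i _; rewrite -!expr2.
Qed.

Lemma horizontal_hvec p a b : horizontal p (hvec p a b).
Proof. by exists a, b. Qed.

Lemma tnorm_hvec p a b : tnorm p (hvec p a b) = hnorm a b.
Proof.
rewrite tnorm_horizontal; last exact: horizontal_hvec.
by congr Num.sqrt; apply: eq_bigr => i _; rewrite xc_hvec yc_hvec.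
Qed.

Lemma hnorm_eq0 a b : hnorm a b = 0 -> forall i, a i = 0 /\ b i = 0.
Proof.
move=> h i; have := sqr_hnorm a b; rewrite h expr0n/= => /esym/psumr_eq0P h0.
have /eqP : a i ^+ 2 + b i ^+ 2 = 0.
  by apply: h0 => // j _; rewrite addr_ge0// sqr_ge0.
by rewrite paddr_eq0 ?sqr_ge0// !sqrf_eq0 => /andP[/eqP-> /eqP->].
Qed.

Lemma cauchy_schwarz a b a' b' :
  \sum_(i < n) (a i * a' i + b i * b' i) <= hnorm a b * hnorm a' b'.
Proof.
set S := \sum_(i < n) _; set A := hnorm a b; set B := hnorm a' b'.
have A0 : 0 <= A by exact: hnorm_ge0.
have B0 : 0 <= B by exact: hnorm_ge0.
(* The square of the norm of [B a - A a'] is [2 A B (A B - S)]. *)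
have : 0 <= \sum_(i < n) ((B * a i - A * a' i) ^+ 2 + (B * b i - A * b' i) ^+ 2).
  exact: hsum_ge0.
have -> : \sum_(i < n) ((B * a i - A * a' i) ^+ 2 + (B * b i - A * b' i) ^+ 2) =
    2 * (A * B) * (A * B - S).
  transitivity (B ^+ 2 * A ^+ 2 + A ^+ 2 * B ^+ 2 - 2 * (A * B) * S); last by ring.
  have -> : B ^+ 2 * A ^+ 2 + A ^+ 2 * B ^+ 2 =
      B ^+ 2 * (\sum_(i < n) (a i ^+ 2 + b i ^+ 2)) +
      A ^+ 2 * (\sum_(i < n) (a' i ^+ 2 + b' i ^+ 2)) by rewrite -!sqr_hnorm.
  rewrite !mulr_sumr -big_split/= -sumrB.
  by apply: eq_bigr => i _; ring.
have [AB0|AB0] := eqVneq (A * B) 0; last first.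
  by rewrite pmulr_rge0 ?subr_ge0// mulr_gt0// lt_neqAle eq_sym AB0 mulr_ge0.
rewrite AB0 => _; move/eqP: AB0; rewrite mulf_eq0 /S => /orP[] /eqP /hnorm_eq0 h.
  by rewrite big1// => i _; have [-> ->] := h i; rewrite !mul0r addr0.
by rewrite big1// => i _; have [-> ->] := h i; rewrite !mulr0 addr0.
Qed.

Lemma cauchy_schwarz_norm a b a' b' :
  `|\sum_(i < n) (a i * a' i + b i * b' i)| <= hnorm a b * hnorm a' b'.
Proof.
rewrite ler_norml lerNl cauchy_schwarz andbT -sumrN.
have -> : hnorm a b = hnorm (fun i => - a i) (fun i => - b i).
  by congr Num.sqrt; apply: eq_bigr => i _; rewrite !sqrrN.
apply: le_trans (cauchy_schwarz _ _ _ _).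
by apply: ler_sum => i _; rewrite opprD !mulNr.
Qed.

End Frame.

(** * Piecewise smooth horizontal curves *)

Section Curves.
Context {R : realType} {n : nat}.
Implicit Types (p q u v w : heis R n) (a b x s : R) (c g : R -> heis R n).
Local Notation mu := (@lebesgue_measure R).

Lemma is_derive_lform (A B : 'I_n -> R) (e : R) g s : derivable g s 1 ->
  is_derive s 1 (fun t => lform A B e (g t)) (lform A B e (derive1 g s)).
Proof.
move=> dg; have H : h^-1 *: (lform A B e (g (h *: (1 : R) + s)) - lform A B e (g s))
    @[h --> 0^'] --> lform A B e (derive1 g s).
  have -> : (fun h : R =>
      h^-1 *: (lform A B e (g (h *: (1 : R) + s)) - lform A B e (g s))) =
    (fun h => lform A B e (h^-1 *: (g (h *: (1 : R) + s) - g s))).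
    by apply/funext => h; rewrite lformZ lformB.
  by apply: continuous_cvg; [exact: lform_continuous|rewrite derive1E; exact: dg].
by split; [apply/cvg_ex; eexists; exact: H|exact/cvg_lim].
Qed.

Lemma smooth_derive1_continuous g : smooth g -> continuous (derive1 g).
Proof.
by move=> sg s; apply/differentiable_continuous/derivable1_diffP; exact: sg 1%N s.
Qed.

Definition speed c s := tnorm (c s) (derive1 c s).

(** For a horizontal curve the speed depends on the horizontal coordinates of
    the velocity only; unlike [speed], this expression is continuous for every
    smooth [g], horizontal or not, hence integrable. *)
Definition hspeed g s := hnorm (xc (derive1 g s)) (yc (derive1 g s)).

Lemma hspeed_continuous g : smooth g -> continuous (hspeed g).
Proof.
move=> sg s; rewrite /hspeed /hnorm.
apply: (@continuous_comp _ _ _ _ (@Num.sqrt R)); last exact: sqrt_continuous.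
apply: cvg_big => [|i _]; first exact: add_continuous.
have dg := smooth_derive1_continuous sg.
have cx : xc (derive1 g t) i @[t --> s] --> xc (derive1 g s) i.
  exact: (@continuous_comp _ _ _ (derive1 g) (fun v => xc v i) s (dg s)
    (@xc_continuous _ _ i _)).
have cy : yc (derive1 g t) i @[t --> s] --> yc (derive1 g s) i.
  exact: (@continuous_comp _ _ _ (derive1 g) (fun v => yc v i) s (dg s)
    (@yc_continuous _ _ i _)).
by apply: cvgD; [exact: (cvgM cx cx)|exact: (cvgM cy cy)].
Qed.

Definition piece c a b := exists g, smooth g /\
  forall z : R, a <= z <= b -> c z = g z /\ horizontal (c z) (derive1 g z).

Notation psh := piecewise_smooth_horizontal.

Lemma psh_refl c a : psh c a a.
Proof. by exists [::]; split. Qed.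

Lemma psh_cons c a x b : a < x -> piece c a x -> psh c x b -> psh c a b.
Proof.
move=> ax pc [l [pl ll hl]]; exists (x :: l); split => //=; first by rewrite ax.
by case=> [|k] //=; rewrite ltnS => /hl.
Qed.

(** Induction on the subdivision, peeling off the first piece; it hides the
    indexing by [nth] of the definition. *)
Lemma psh_ind (P : R -> Prop) c b : P b ->
  (forall a x, a < x -> piece c a x -> psh c x b -> P x -> P a) ->
  forall a, psh c a b -> P a.
Proof.
move=> Pb IH a [l [+ + +]]; elim: l a => [a _ /= -> //|x l IHl a /= /andP[ax pl] ll hl].
have hl' k : (k < size l)%N -> _ := fun h => hl k.+1 h.
apply: (IH _ x ax); [exact: (hl 0%N)|by exists l|exact: IHl].
Qed.

Lemma psh_le c a b : psh c a b -> a <= b.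
Proof.
move: a; apply: psh_ind => // a x ax _ _; exact/le_trans/ltW.
Qed.

Lemma piece_eq c c' a b : (forall z, a <= z <= b -> c z = c' z) ->
  piece c a b -> piece c' a b.
Proof.
by move=> e [g [sg hg]]; exists g; split => // z zab; rewrite -e//; exact: hg.
Qed.

Lemma psh_eq c c' a b : (forall z, a <= z <= b -> c z = c' z) ->
  psh c a b -> psh c' a b.
Proof.
move=> + h; move: a h; apply: psh_ind => [_|a x ax pax xb IH e]; first exact: psh_refl.
have lxb := psh_le xb.
apply: (psh_cons ax).
  by apply: piece_eq pax => z /andP[az zx]; rewrite e// az (le_trans zx).
by apply: IH => z /andP[xz zb]; rewrite e// zb (le_trans (ltW ax)).
Qed.

Lemma derive1_eq_itv c g a b s : a < s < b -> (forall z, a < z < b -> c z = g z) ->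
  derive1 c s = derive1 g s.
Proof.
move=> asb e; rewrite !derive1E; apply: near_eq_derive.
have sI : s \in `]a, b[ by rewrite in_itv.
by apply: filterS (near_in_itvoo sI) => z; rewrite in_itv; exact: e.
Qed.

(** At a point of the subdivision the derivative of the curve carries no
    information, so the speed is controlled on open intervals only; end points
    are negligible. *)
Lemma integrable_itv_closed (h : R -> R) a b :
  mu.-integrable `]a, b[ (EFin \o h) -> mu.-integrable `[a, b] (EFin \o h).
Proof.
move=> /integrableP[mh ih]; apply/integrableP; split.
  exact: emeasurable_fun_itv_cc mh.
by rewrite integral_itv_bndoo//; exact: measurableT_comp.
Qed.

Lemma integrable_itv_cat (h : R -> R) a x b : a <= x -> x <= b ->
  mu.-integrable `[a, x] (EFin \o h) -> mu.-integrable `[x, b] (EFin \o h) ->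
  mu.-integrable `[a, b] (EFin \o h).
Proof.
move=> ax xb /integrableP[m1 i1] ixb.
have /integrableP[m2 i2] : mu.-integrable `]x, b] (EFin \o h).
  by apply: integrableS ixb => //; apply: subset_itvr; rewrite bnd_simp.
have <- : `[a, x] `|` `]x, b] = `[a, b]%classic.
  by apply/esym/itv_bndbnd_setU; rewrite bnd_simp.
apply/integrableP; split; first exact/measurable_funU.
rewrite ge0_integral_setU//; [exact: lte_add_pinfty| |].
- by apply: measurableT_comp => //; exact/measurable_funU.
- apply/disj_setPLR => z /=; rewrite !in_itv/= => /andP[_ zx].
  by apply/negP; rewrite negb_and -leNgt zx.
Qed.

Lemma hspeed_integrable g a b : smooth g -> mu.-integrable `[a, b] (EFin \o hspeed g).
Proof.
move=> sg; apply: continuous_compact_integrable; first exact: segment_compact.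
by apply: continuous_subspaceT; exact: hspeed_continuous.
Qed.

Let itv_ooW a b z : a < z < b -> a <= z <= b.
Proof. by move=> /andP[/ltW-> /ltW->]. Qed.

Lemma speed_hspeed c g a b :
  (forall z, a <= z <= b -> c z = g z /\ horizontal (c z) (derive1 g z)) ->
  {in `]a, b[, speed c =1 hspeed g}.
Proof.
move=> h z; rewrite in_itv/= => zab; rewrite /speed (derive1_eq_itv zab (g := g)).
  by have [_ hz] := h z (itv_ooW zab); rewrite tnorm_horizontal.
by move=> y yab; have [] := h y (itv_ooW yab).
Qed.

Lemma speed_integrable_piece c a b :
  piece c a b -> mu.-integrable `[a, b] (EFin \o speed c).
Proof.
move=> [g [sg hg]]; apply: integrable_itv_closed.
refine (@eq_integrable _ _ _ mu `]a, b[%classic _ (EFin \o hspeed g) _ _ _) => //.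
  by move=> z; rewrite inE/= => zab; rewrite (speed_hspeed hg).
by apply: integrableS (hspeed_integrable a b sg) => //; exact: subset_itv_oo_cc.
Qed.

Lemma length_hspeed c g a b : smooth g ->
  (forall z, a <= z <= b -> c z = g z /\ horizontal (c z) (derive1 g z)) ->
  curve_length c a b = Rintegral mu `[a, b] (hspeed g).
Proof.
move=> sg hg; rewrite /curve_length /Rintegral; congr fine.
apply: eq_integral_itv_bounded.
- have /integrableP[+ _] : mu.-integrable `[a, b] (EFin \o speed c).
    by apply: speed_integrable_piece; exists g.
  move=> /measurable_EFinP; apply: measurable_funS => //; exact: subset_itv_oo_cc.
- have /integrableP[+ _] := hspeed_integrable a b sg.
  move=> /measurable_EFinP; apply: measurable_funS => //; exact: subset_itv_oo_cc.
- exact: speed_hspeed.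
Qed.

Lemma speed_integrable c a b : psh c a b -> mu.-integrable `[a, b] (EFin \o speed c).
Proof.
move: a; apply: psh_ind => [|a x ax pax pxb ixb].
  apply: integrable_itv_closed; rewrite set_itv_ge ?bnd_simp ?ltxx//.
  exact: integrable_set0.
apply: (integrable_itv_cat (ltW ax) (psh_le pxb) _ ixb).
exact: speed_integrable_piece.
Qed.

Lemma length_ge0 c a b : 0 <= curve_length c a b.
Proof. by apply: Rintegral_ge0 => z _; exact: sqrtr_ge0. Qed.

Lemma length_refl c a : curve_length c a a = 0.
Proof. by rewrite /curve_length set_itv1 Rintegral_set1. Qed.

Lemma psh_cat c a x b : psh c a x -> psh c x b -> psh c a b.
Proof.
by move=> + pxb; move: a; apply: psh_ind => // a y ay pay _; exact: psh_cons.
Qed.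

Lemma length_cat c a x b : psh c a x -> psh c x b ->
  curve_length c a b = curve_length c a x + curve_length c x b.
Proof.
move=> pax pxb; have ax := psh_le pax; have xb := psh_le pxb.
have iab := speed_integrable (psh_cat pax pxb).
have /eqP : curve_length c a b - curve_length c a x = curve_length c x b.
  rewrite /curve_length Rintegral_itvB ?bnd_simp// Rintegral_itv_obnd_cbnd//.
  by apply: integrableS (speed_integrable pxb) => //; apply: subset_itvr; rewrite bnd_simp.
by rewrite subr_eq addrC => /eqP.
Qed.

Lemma piece_sub c a b a' b' : a <= a' -> b' <= b -> piece c a b -> piece c a' b'.
Proof.
move=> aa' bb' [g [sg hg]]; exists g; split => // z /andP[az zb].
by apply: hg; rewrite (le_trans aa')// (le_trans zb).
Qed.

Lemma psh_piece c a b : a <= b -> piece c a b -> psh c a b.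
Proof.
rewrite le_eqVlt => /predU1P[->|ab] p; first exact: psh_refl.
by apply: (psh_cons ab p); exact: psh_refl.
Qed.

Section growth.
Variables (A B : 'I_n -> R) (e K : R).
Local Notation phi := (lform A B e).

(** The fundamental theorem of calculus for the form along the smooth extension
    [g], followed by the pointwise bound under the integral. *)
Lemma growth_piece c a b : a < b -> piece c a b ->
  (forall z, a <= z <= b -> forall v, horizontal (c z) v -> phi v <= K * tnorm (c z) v) ->
  phi (c b) - phi (c a) <= K * curve_length c a b.
Proof.
move=> ab [g [sg hg]] hK; rewrite (length_hspeed sg hg).
have [-> _] := hg b (introT andP (conj (ltW ab) (lexx b))).
have [-> _] := hg a (introT andP (conj (lexx a) (ltW ab))).
have dphi s : is_derive s 1 (fun t => phi (g t)) (phi (derive1 g s)).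
  by apply: is_derive_lform; exact: (sg 0%N).
have cphi : continuous (fun t => phi (derive1 g t)).
  move=> s; apply: (@continuous_comp _ _ _ (derive1 g) phi).
    exact: smooth_derive1_continuous.
  exact: lform_continuous.
have cF : continuous (fun t => phi (g t)).
  by move=> s; apply/differentiable_continuous/derivable1_diffP.
have iphi : mu.-integrable `[a, b] (EFin \o (fun t => phi (derive1 g t))).
  apply: continuous_compact_integrable; first exact: segment_compact.
  exact: continuous_subspaceT.
have <- : Rintegral mu `[a, b] (fun t => phi (derive1 g t)) = phi (g b) - phi (g a).
  rewrite /Rintegral (@continuous_FTC2 _ _ (fun t => phi (g t)))//.
  - exact: continuous_subspaceT.
  - split => [s _||]; first exact: ex_derive.
      by apply: cvg_at_right_filter; exact: cF.
    by apply: cvg_at_left_filter; exact: cF.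
  - by move=> s _; rewrite derive1E derive_val.
rewrite -RintegralZl//; last exact: hspeed_integrable.
apply: le_Rintegral => //.
  apply: continuous_compact_integrable; first exact: segment_compact.
  apply: continuous_subspaceT => z; apply: cvgMl_tmp; exact: hspeed_continuous.
move=> z /=; rewrite in_itv/= => zab; have [_ hz] := hg z zab.
by rewrite /hspeed -(tnorm_horizontal hz); exact: hK.
Qed.

(** Summing [growth_piece] over the subdivision.  The bound is stated at every
    intermediate time [s], because [vertical_le_length] needs the whole curve to
    stay close to its starting point. *)
Lemma growth c a b : 0 <= K -> psh c a b ->
  (forall z, a <= z <= b -> forall v, horizontal (c z) v -> phi v <= K * tnorm (c z) v) ->
  forall s, a <= s <= b -> phi (c s) - phi (c a) <= K * curve_length c a b.
Proof.
move=> K0; move: a; apply: psh_ind => [_ s|a x ax pax pxb IH hK s /andP[as_ sb]].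
  by move=> /le_anti ->; rewrite subrr length_refl mulr0.
have xb := psh_le pxb.
rewrite (length_cat (psh_piece (ltW ax) pax) pxb) mulrDr.
have [xs|sx] := leP x s.
  rewrite -(subrKA (phi (c x))) addrC; apply: lerD.
    apply: growth_piece => // z /andP[az zx]; apply: hK.
    by rewrite az (le_trans zx).
  apply: IH; rewrite ?xs// => z /andP[xz zb]; apply: hK.
  by rewrite zb (le_trans (ltW ax)).
rewrite -[leLHS]addr0; apply: lerD; last by rewrite mulr_ge0// length_ge0.
move: as_; rewrite le_eqVlt => /predU1P[<-|as_].
  by rewrite subrr mulr_ge0// length_ge0.
have pas : piece c a s by apply: piece_sub pax => //; exact: ltW.
have psx : piece c s x by apply: piece_sub pax => //; exact: ltW.
rewrite (length_cat (psh_piece (ltW as_) pas) (psh_piece (ltW sx) psx)) mulrDr.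
rewrite -[leLHS]addr0; apply: lerD; last by rewrite mulr_ge0// length_ge0.
apply: growth_piece => // z /andP[az zs]; apply: hK.
by rewrite az (le_trans zs).
Qed.

End growth.

(** Take for linear form the scalar product with the horizontal displacement
    itself, which Cauchy-Schwarz bounds by the speed. *)
Lemma hdist_le_length c a b s : psh c a b -> a <= s <= b ->
  hnorm (xc (c s - c a)) (yc (c s - c a)) <= curve_length c a b.
Proof.
move=> pc sab; set A := xc _; set B := yc _.
have : lform A B 0 (c s) - lform A B 0 (c a) <= hnorm A B * curve_length c a b.
  apply: growth => //; first exact: hnorm_ge0.
  move=> z _ v hv; rewrite tnorm_horizontal// /lform mul0r addr0.
  exact: cauchy_schwarz.
rewrite -lformB {1}/lform mul0r addr0.
have -> : \sum_(i < n) (A i * xc (c s - c a) i + B i * yc (c s - c a) i) =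
    hnorm A B * hnorm A B.
  by rewrite -expr2 sqr_hnorm; apply: eq_bigr => i _; rewrite !expr2.
have [h0 _|h0] := eqVneq (hnorm A B) 0; first by rewrite h0 length_ge0.
by rewrite ler_pM2l// lt_neqAle eq_sym h0 hnorm_ge0.
Qed.

(** The rate of change of the vertical part relative to the starting point is the
    symplectic product of the horizontal velocity and the horizontal
    displacement.  The displacement is at most the length by [hdist_le_length],
    so the form grows at most like the square of the length. *)
Lemma vertical_le_length c a b : psh c a b ->
  `|vertical_part (c a) (c b - c a)| <= curve_length c a b ^+ 2.
Proof.
move=> pc; have ab := psh_le pc; have l0 := length_ge0 c a b.
set q := c a; set p := c b.
have key z v : a <= z <= b -> horizontal (c z) v ->
    `|vertical_part q v| <= curve_length c a b * tnorm (c z) v.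
  move=> zab hv; rewrite tnorm_horizontal//.
  have -> : vertical_part q v =
      \sum_(i < n) (yc (c z - q) i * xc v i + - xc (c z - q) i * yc v i).
    move/vertical_horizontal: hv; rewrite /vertical_part => /eqP.
    rewrite subr_eq0 => /eqP ->; rewrite -sumrB; apply: eq_bigr => i _.
    by rewrite !coordE /q /xc /yc !mxE; ring.
  apply: (@le_trans _ _ (hnorm (xc (c z - q)) (yc (c z - q)) * hnorm (xc v) (yc v))).
    rewrite [leRHS](_ : _ = hnorm (yc (c z - q)) (fun i => - xc (c z - q) i) *
        hnorm (xc v) (yc v)); first exact: cauchy_schwarz_norm.
    congr (_ * _); congr Num.sqrt; apply: eq_bigr => i _.
    by rewrite sqrrN addrC.
  by apply: ler_wpM2r; [exact: hnorm_ge0|exact: hdist_le_length].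
have l_b : a <= b <= b by rewrite ab lexx.
rewrite expr2 ler_norml lerNl vertical_partE; apply/andP; split.
  rewrite lformN lformB; apply: growth => // z zab v hv.
  by rewrite -lformN -vertical_partE (le_trans (ler_norm _))// normrN key.
rewrite lformB; apply: growth => // z zab v hv.
by rewrite -vertical_partE (le_trans (ler_norm _))// key.
Qed.

End Curves.

(** * Horizontal lines and polygons *)

Section Joining.
Context {R : realType} {n : nat}.
Implicit Types (p q u v w : heis R n) (a b x s : R) (c g : R -> heis R n).
Local Notation mu := (@lebesgue_measure R).
Local Notation psh := piecewise_smooth_horizontal.

(** The contributions of the displacement to [X_i] and [Y_i] cancel, because the
    symplectic form is alternating. *)
Lemma horizontal_line w V (h : R) : horizontal w V -> horizontal (w + h *: V) V.
Proof.
move=> hV; rewrite {2}(frame_decomp (w + h *: V) V).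
have -> : vertical_part (w + h *: V) V = 0.
  rewrite -(vertical_horizontal hV) /vertical_part; congr (_ - _).
  by apply: eq_bigr => i _; rewrite !coordE; ring.
by rewrite scale0r addr0; exact: horizontal_hvec.
Qed.

Definition line w V b s : heis R n := w + (s - b) *: V.

Lemma is_derive_line w V b s : is_derive s 1 (line w V b) V.
Proof.
have H : h^-1 *: (line w V b (h *: (1 : R) + s) - line w V b s) @[h --> 0^'] --> V.
  apply: cvg_near_cst; near=> h; have h0 : h != 0 by near: h; exact: nbhs_dnbhs_neq.
  by rewrite /line opprD addrACA subrr add0r -scalerBl [h%:A]mulr1 opprB addrA subrK
    addrK scalerA mulVf// scale1r.
by split; [apply/cvg_ex; eexists; exact: H|exact/cvg_lim].
Unshelve. all: by end_near. Qed.

Lemma derive1_line w V b : derive1 (line w V b) = cst V.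
Proof.
by apply/funext => s; rewrite derive1E;
  exact: (@derive_val _ _ _ _ _ _ _ (is_derive_line w V b s)).
Qed.

Lemma derive1n_cst k (V : heis R n) : derive1n k.+1 (cst V : R -> heis R n) = cst 0.
Proof.
elim: k => [|k IH].
  by apply/funext => s; rewrite derive1n1 derive1E derive_cst.
by rewrite derive1nS IH; apply/funext => s; rewrite derive1E derive_cst.
Qed.

Lemma line_smooth w V b : smooth (line w V b).
Proof.
move=> [|k] s; first by have [] := is_derive_line w V b s.
rewrite derive1Sn derive1_line; case: k => [|k]; first exact: derivable_cst.
by rewrite derive1n_cst; exact: derivable_cst.
Qed.

Lemma hnormZ (k : R) (A B : 'I_n -> R) :
  hnorm (fun i => k * A i) (fun i => k * B i) = `|k| * hnorm A B.
Proof.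
rewrite /hnorm -sqrtr_sqr -sqrtrM ?sqr_ge0//; congr Num.sqrt.
by rewrite mulr_sumr; apply: eq_bigr => i _; ring.
Qed.

Lemma curve_length_eq c c' a b : (forall z, a <= z <= b -> c z = c' z) ->
  psh c a b -> curve_length c a b = curve_length c' a b.
Proof.
move=> e pc; apply: (congr1 fine).
have ms c1 : psh c1 a b -> measurable_fun `]a, b[ (speed c1).
  move=> /speed_integrable/integrableP[/measurable_EFinP + _].
  by apply: measurable_funS => //; exact: subset_itv_oo_cc.
apply: eq_integral_itv_bounded; [exact: ms|exact: ms (psh_eq e pc)|].
have W z : a < z < b -> a <= z <= b by move=> /andP[/ltW-> /ltW->].
move=> z; rewrite in_itv/= => zab; rewrite /speed (e _ (W _ zab)).
by rewrite (derive1_eq_itv zab (g := c')) // => y /W /e.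
Qed.

(** The set of lengths of which [ccdist] is the infimum. *)
Definition joins p q : set R := [set l | exists (a b : R) c,
    [/\ a <= b, piecewise_smooth_horizontal c a b, c a = p, c b = q &
        l = curve_length c a b]].

Lemma joins_refl p : joins p p 0.
Proof.
by exists 0, 0, (cst p); split; rewrite ?length_refl//; exact: psh_refl.
Qed.

(** The straight segment is parametrised by the unit interval that follows the
    domain of the curve, so that the two lengths simply add up. *)
Lemma joins_extend p w V (l : R) :
  joins p w l -> horizontal w V -> joins p (w + V) (l + tnorm w V).
Proof.
move=> [a [b [c [ab pc ca cb ->]]]] hV.
pose g := line w V b.
pose c' s := if s <= b then c s else g s.
have e1 z : a <= z <= b -> c z = c' z by move=> /andP[_ zb]; rewrite /c' zb.
have e2 z : b <= z <= b + 1 -> c' z = g z /\ horizontal (c' z) (derive1 g z).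
  move=> /andP[bz _]; have c'g : c' z = g z.
    rewrite /c'; case: leP => // zb; have -> : z = b by apply/le_anti; rewrite zb.
    by rewrite cb /g /line subrr scale0r addr0.
  by rewrite c'g derive1_line; split => //; exact: horizontal_line.
have sg : smooth g by exact: line_smooth.
have bb : b < b + 1 by rewrite ltrDl.
have p2 : psh c' b (b + 1).
  by apply: psh_piece; [exact: ltW|exists g].
have p1 : psh c' a b by exact: psh_eq e1 pc.
exists a, (b + 1), c'; split.
- by rewrite (le_trans ab)// ltW.
- exact: psh_cat p1 p2.
- by rewrite -e1 ?lexx.
- rewrite /c' lt_geF// /g /line (addrC b) addrK; by rewrite scale1r.
- rewrite (length_cat p1 p2) -(curve_length_eq e1 pc); congr (_ + _).
  rewrite (length_hspeed sg e2) /hspeed derive1_line /=.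
  rewrite Rintegral_cst//= lebesgue_measure_itv/= lte_fin bb -EFinD/=.
  by rewrite addrAC subrr add0r mulr1 tnorm_horizontal.
Qed.

(** The [2 n] fields [X_i] (for [true]) and [Y_i] (for [false]) as one family, so
    that a polygon is a sequence of triples: field, index, signed length of side. *)
Definition frame (d : bool) (i : 'I_n) p := if d then X_ i p else Y_ i p.

Lemma xc_frame d i p k : xc (frame d i p) k = (d && (i == k))%:R.
Proof. by case: d; rewrite /frame /xc /= mxE ?eqxx//= eq_sym. Qed.

Lemma yc_frame d i p k : yc (frame d i p) k = (~~ d && (i == k))%:R.
Proof. by case: d; rewrite /frame /yc /= mxE ?eqxx//= eq_sym. Qed.

Lemma tc_frame d i p : tc (frame d i p) = if d then yc p i else - xc p i.
Proof. by case: d. Qed.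

Lemma horizontal_frame d i p : horizontal p (frame d i p).
Proof.
exists (fun k => (d && (i == k))%:R), (fun k => (~~ d && (i == k))%:R).
apply: heis_eqP => [k|k|].
- by rewrite xc_frame -/(hvec _ _ _) xc_hvec.
- by rewrite yc_frame -/(hvec _ _ _) yc_hvec.
rewrite tc_frame -/(hvec _ _ _) tc_hvec (bigD1 i)//= eqxx !andbT big1.
  by case: d => /=; ring.
by move=> j ji; rewrite [i == j]eq_sym (negPf ji) !andbF !mul0r subrr.
Qed.

Lemma horizontalZ (k : R) p v : horizontal p v -> horizontal p (k *: v).
Proof.
move=> [A [B ->]]; exists (fun i => k * A i), (fun i => k * B i).
by rewrite scaler_sumr; apply: eq_bigr => i _; rewrite scalerDr !scalerA.
Qed.

Lemma tnormZ (k : R) p v : horizontal p v -> tnorm p (k *: v) = `|k| * tnorm p v.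
Proof.
move=> hv; rewrite !tnorm_horizontal//; last exact: horizontalZ.
by rewrite -hnormZ; congr Num.sqrt; apply: eq_bigr => i _; rewrite !coordE.
Qed.

Lemma tnorm_frame d i p : tnorm p (frame d i p) = 1.
Proof.
have [hX hY _ _ _] := metric_orthonormal p.
by case: d; rewrite /tnorm /frame ?hX ?hY eqxx sqrtr1.
Qed.

Implicit Types l : seq (bool * 'I_n * R).

Definition hstep p (st : bool * 'I_n * R) := p + st.2 *: frame st.1.1 st.1.2 p.

Definition cost l := \sum_(st <- l) `|st.2|.

(** The value that a covector with components [D] along the frame takes on the
    total horizontal displacement of the polygon. *)
Definition lsum (D : bool -> 'I_n -> R) l := \sum_(st <- l) st.2 * D st.1.1 st.1.2.

Lemma joins_moves_from p w l (L : R) :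
  joins p w L -> joins p (foldl hstep w l) (L + cost l).
Proof.
elim: l w L => [|st l IH] w L; first by rewrite /cost big_nil addr0.
move=> j; rewrite /cost big_cons addrA; apply: IH.
have hf := horizontal_frame st.1.1 st.1.2 w.
have := joins_extend j (horizontalZ st.2 hf).
by rewrite tnormZ// tnorm_frame mulr1.
Qed.

Lemma joins_moves p l : joins p (foldl hstep p l) (cost l).
Proof. by rewrite -[cost l]add0r; apply: joins_moves_from; exact: joins_refl. Qed.

Lemma frame_move d i p (k : R) : frame d i (p + k *: frame d i p) = frame d i p.
Proof.
apply: heis_eqP => [j|j|]; rewrite ?xc_frame ?yc_frame ?tc_frame//.
by case: d; rewrite !coordE ?xc_frame ?yc_frame/=; ring.
Qed.

Lemma xc_moves p l k :
  xc (foldl hstep p l) k = xc p k + lsum (fun d i => (d && (i == k))%:R) l.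
Proof.
elim: l p => [|st l IH] p /=; first by rewrite /lsum big_nil addr0.
by rewrite IH /lsum big_cons /hstep !coordE xc_frame addrA.
Qed.

Lemma yc_moves p l k :
  yc (foldl hstep p l) k = yc p k + lsum (fun d i => (~~ d && (i == k))%:R) l.
Proof.
elim: l p => [|st l IH] p /=; first by rewrite /lsum big_nil addr0.
by rewrite IH /lsum big_cons /hstep !coordE yc_frame addrA.
Qed.

Lemma cost_ge0 l : 0 <= cost l.
Proof. by apply: sumr_ge0. Qed.

Lemma vertical_moves p l : `|vertical_part p (foldl hstep p l - p)| <= cost l ^+ 2.
Proof.
have [a [b [c [ab pc <- <- ->]]]] := joins_moves p l.
exact: vertical_le_length.
Qed.

End Joining.

(** * The Carnot-Caratheodory distance *)

Section Distance.
Context {R : realType} {n : nat} (i0 : 'I_n).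
Implicit Types (p q u v w : heis R n).

(** Length of the polygon of [connect] in units of [eta]: [2 n] for the sides that
    reach the horizontal coordinates, [4 n^2 + 3] for the correcting
    parallelogram. *)
Definition connect_cst : R := 4 * n%:R ^+ 2 + 2 * n%:R + 3.

Lemma connect_cst_gt0 : 0 < connect_cst.
Proof.
have n0 : 0 <= n%:R :> R by exact: ler0n.
rewrite /connect_cst; nra.
Qed.

(** Sides along the [X_i], then along the [Y_i], reach the right horizontal
    coordinates; by [vertical_moves] the vertical error made is at most the square
    of their length, of order [eta ^+ 2].  A parallelogram in the directions
    [X_i0] and [Y_i0] then corrects it: it changes the vertical coordinate by
    twice its area and leaves the horizontal ones as they are.  Its sides cancel
    in every [lsum], so the polygon has the expected total displacement. *)
Lemma connect p q (eta : R) : 0 < eta ->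
  (forall i, `|xc (p - q) i| <= eta) -> (forall i, `|yc (p - q) i| <= eta) ->
  `|vertical_part q (p - q)| <= eta ^+ 2 ->
  exists l, [/\ foldl hstep q l = p, cost l <= connect_cst * eta &
    forall D : bool -> 'I_n -> R, lsum D l =
      \sum_(i < n) (xc (p - q) i * D true i + yc (p - q) i * D false i)].
Proof.
move=> eta0 hx hy ht.
pose l1 := [seq (true, i, xc (p - q) i) | i <- index_enum 'I_n] ++
           [seq (false, i, yc (p - q) i) | i <- index_enum 'I_n].
have l1E (D : bool -> 'I_n -> R) : lsum D l1 =
      \sum_(i < n) (xc (p - q) i * D true i + yc (p - q) i * D false i).
  by rewrite /lsum big_cat/= !big_map/= big_split.
have cl1 : cost l1 <= 2 * n%:R * eta.
  have bnd (F : 'I_n -> R) : (forall i, `|F i| <= eta) -> \sum_(i < n) `|F i| <= n%:R * eta.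
    move=> hF; apply: (@le_trans _ _ (\sum_(i < n) eta)); first exact: ler_sum.
    by rewrite sumr_const card_ord mulr_natl.
  rewrite /cost big_cat/= !big_map/= -mulrA mulr2n mulrDl !mul1r.
  by apply: lerD; exact: bnd.
set e := foldl hstep q l1.
have xe k : xc e k = xc p k.
  rewrite xc_moves l1E (bigD1 k)//= eqxx big1 => [|i /negPf ->].
    by rewrite mulr1 mulr0 !addr0 /xc !mxE addrCA subrr addr0.
  by rewrite !mulr0 addr0.
have ye k : yc e k = yc p k.
  rewrite yc_moves l1E (bigD1 k)//= eqxx big1 => [|i /negPf ->].
    by rewrite mulr1 mulr0 add0r !addr0 /yc !mxE addrCA subrr addr0.
  by rewrite !mulr0 addr0.
(* The vertical error to be corrected by a parallelogram of sides [eta] and [b]. *)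
pose kappa := tc p - tc e.
have kE : kappa = vertical_part q (p - q) - vertical_part q (e - q).
  rewrite /vertical_part /kappa.
  have -> : \sum_(i < n) (xc (e - q) i * yc q i - yc (e - q) i * xc q i) =
            \sum_(i < n) (xc (p - q) i * yc q i - yc (p - q) i * xc q i).
    apply: eq_bigr => i _.
    by have := xe i; have := ye i; rewrite /xc /yc !mxE => -> ->.
  by rewrite /tc/=; ring.
have kle : `|kappa| <= (4 * n%:R ^+ 2 + 1) * eta ^+ 2.
  rewrite kE (le_trans (ler_normB _ _))// mulrDl mul1r addrC lerD//.
  rewrite (le_trans (vertical_moves q l1))//.
  rewrite (_ : 4 * _ * _ = (2 * n%:R * eta) ^+ 2); last by ring.
  by rewrite lerXn2r// nnegrE ?cost_ge0// !mulr_ge0// ltW.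
(* The commutator of sides [eta] and [b] moves the last coordinate by
   [- 2 * eta * b]. *)
pose b := - (kappa / (2 * eta)).
pose l2 := [:: (true, i0, eta); (false, i0, b); (true, i0, - eta); (false, i0, - b)].
have ble : `|b| <= (4 * n%:R ^+ 2 + 1) / 2 * eta.
  rewrite /b normrN normrM normfV (gtr0_norm (x := 2 * eta)) ?mulr_gt0//.
  rewrite ler_pdivrMr ?mulr_gt0// (le_trans kle)//.
  by rewrite le_eqVlt; apply/orP; left; apply/eqP; field.
have l2E (D : bool -> 'I_n -> R) : lsum D l2 = 0.
  by rewrite /lsum !big_cons big_nil/=; ring.
exists (l1 ++ l2); split.
- rewrite foldl_cat -/e; apply: heis_eqP => [k|k|].
  + by rewrite xc_moves l2E addr0.
  + by rewrite yc_moves l2E addr0.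
  rewrite /l2 /= /hstep /= /frame !coordE.
  rewrite /X_ /Y_ /tc /xc /yc /= !mxE !eqxx /=.
  have -> : p.2 = e.2 + kappa by rewrite /kappa /tc addrCA subrr addr0.
  rewrite /GRing.scale /=.
  have h : 2 * eta * b = - kappa; last first.
    have -> : kappa = - (2 * eta * b) by rewrite h opprK.
    by ring.
  by rewrite /b mulrN mulrC divfK// mulf_neq0 ?gt_eqF.
- rewrite {1}/cost big_cat/= -/(cost _) -/(cost _).
  have -> : cost l2 = 2 * eta + 2 * `|b|.
    by rewrite /cost !big_cons big_nil/= !normrN (gtr0_norm eta0); ring.
  rewrite /connect_cst; move: cl1 ble; set N : R := n%:R; set B := `|b|; nra.
- by move=> D; rewrite {1}/lsum big_cat/= -/(lsum _ _) -/(lsum _ _) l1E l2E addr0.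
Qed.

(** A finite distance: without it the infimum defining [ccdist] would be that of
    an empty set, and lower bounds on lengths would say nothing. *)
Lemma joinable p q : exists l, joins p q l.
Proof.
pose eta : R := 1 + \sum_i `|xc (q - p) i| + \sum_i `|yc (q - p) i| +
  `|vertical_part p (q - p)|.
have le1 (F : 'I_n -> R) i : `|F i| <= \sum_j `|F j|.
  by rewrite (bigD1 i)//= lerDl; apply: sumr_ge0.
have s0 (F : 'I_n -> R) : 0 <= \sum_j `|F j| by apply: sumr_ge0.
have := s0 (xc (q - p)); have := s0 (yc (q - p)).
have := normr_ge0 (vertical_part p (q - p)).
have := le1 (xc (q - p)); have := le1 (yc (q - p)).
move=> hy hx v0 y0 x0.
have eta1 : 1 <= eta by rewrite /eta; lra.
have [||||l [<- _ _]] := @connect q p eta.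
- by lra.
- by move=> i; apply: le_trans (hx i) _; rewrite /eta; lra.
- by move=> i; apply: le_trans (hy i) _; rewrite /eta; lra.
- apply: (@le_trans _ _ eta); first by rewrite /eta; lra.
  by rewrite expr2 ler_peMl//; lra.
by exists (cost l); exact: joins_moves.
Qed.

Lemma joins_ge0 p q l : joins p q l -> 0 <= l.
Proof. by move=> [a [b [c [_ _ _ _ ->]]]]; exact: length_ge0. Qed.

Lemma ccdist_ge0 p q : 0 <= ccdist p q.
Proof.
have [l pql] := joinable p q.
by apply: lb_le_inf; [exists l|exact: joins_ge0].
Qed.

Lemma ccdist_le p q l : joins p q l -> ccdist p q <= l.
Proof. by apply: ge_inf; exists 0; exact: joins_ge0. Qed.

Lemma ccdist_ge p q (m : R) : (forall l, joins p q l -> m <= l) -> m <= ccdist p q.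
Proof. by move=> h; have [l pql] := joinable p q; apply: lb_le_inf; [exists l|]. Qed.

(** Triangle inequality, for a second path that is a straight horizontal line. *)
Lemma ccdist_extend p w v : horizontal w v ->
  ccdist p (w + v) <= ccdist p w + tnorm w v.
Proof.
move=> hv; rewrite -lerBlDr; apply: ccdist_ge => l pwl.
by rewrite lerBlDr; apply: ccdist_le; exact: joins_extend.
Qed.

Lemma ccdist_refl p : ccdist p p = 0.
Proof.
apply/le_anti; rewrite ccdist_ge0 andbT; apply: ccdist_le.
exact: joins_refl.
Qed.

Lemma hdist_le_ccdist p q : hnorm (xc (q - p)) (yc (q - p)) <= ccdist p q.
Proof.
apply: ccdist_ge => l [a [b [c [ab pc <- <- ->]]]].
by apply: hdist_le_length => //; rewrite ab lexx.
Qed.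

(** The bound on lengths passes to the infimum after taking square roots. *)
Lemma vertical_le_ccdist p q : `|vertical_part p (q - p)| <= ccdist p q ^+ 2.
Proof.
rewrite -[leLHS]sqr_sqrtr// lerXn2r ?nnegrE ?sqrtr_ge0 ?ccdist_ge0//.
apply: ccdist_ge => l [a [b [c [ab pc <- <- ->]]]].
rewrite -[leRHS](ger0_norm (length_ge0 c a b)).
rewrite -(sqrtr_sqr (curve_length c a b)) ler_sqrt ?sqr_ge0//.
exact: vertical_le_length.
Qed.

Lemma coord_le_hnorm (A B : 'I_n -> R) i : `|A i| <= hnorm A B /\ `|B i| <= hnorm A B.
Proof.
have S : A i ^+ 2 + B i ^+ 2 <= hnorm A B ^+ 2.
  rewrite sqr_hnorm (bigD1 i)//= lerDl; apply: sumr_ge0 => j _.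
  by rewrite addr_ge0// sqr_ge0.
split; rewrite -ler_sqr ?nnegrE ?hnorm_ge0// real_normK ?num_real//;
  by apply: le_trans S; rewrite ?lerDl ?lerDr sqr_ge0.
Qed.

End Distance.

(** * First-order expansion of functions of class C1H *)

Section Differentiability.
Context {R : realType} {n : nat} (i0 : 'I_n).
Implicit Types (p q u v w : heis R n) (f : heis R n -> R).

(** The components of [p - q] in the frame at [q] are bounded by the distance and
    its square, so small distance implies small Euclidean norm. *)
Lemma nbhs_ccdist q (A : set (heis R n)) : nbhs q A ->
  exists2 d : R, 0 < d & forall p, ccdist q p < d -> A p.
Proof.
move=> /nbhs_normP[e /= e0 eA].
pose M : R := \sum_(i < n) (`|X_ i q| + `|Y_ i q|) + `|T_ q|.
have M0 : 0 <= M by rewrite addr_ge0// sumr_ge0// => i _; rewrite addr_ge0.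
have M1 : 0 < M + 1 by rewrite ltr_wpDl.
exists (Num.min 1 (e / (M + 1))); first by rewrite lt_min ltr01 divr_gt0.
move=> p; rewrite lt_min => /andP[d1]; rewrite ltr_pdivlMr// => de; apply: eA => /=.
rewrite distrC; apply: le_lt_trans de.
have d0 := ccdist_ge0 i0 q p; have hd := hdist_le_ccdist i0 q p.
have hv := vertical_le_ccdist i0 q p.
rewrite {1}(frame_decomp q (p - q)).
apply: (@le_trans _ _ (ccdist q p * M)); last by rewrite ler_wpM2l// lerDl.
rewrite /M mulrDr; apply: (le_trans (ler_normD _ _)); apply: lerD.
  rewrite mulr_sumr; apply: (le_trans (ler_norm_sum _ _ _)); apply: ler_sum => i _.
  have [hx hy] := coord_le_hnorm (xc (p - q)) (yc (p - q)) i.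
  rewrite mulrDr; apply: (le_trans (ler_normD _ _)); rewrite !normrZ.
  by apply: lerD; apply: ler_wpM2r => //; [apply: le_trans hx hd|apply: le_trans hy hd].
rewrite normrZ ler_wpM2r// (le_trans hv)// expr2.
by apply: ler_piMr => //; exact: ltW.
Qed.

(** Mean value theorem for [t |-> f (p + t v)] between [0] and [k]. *)
Lemma segment_increment f p v (k D eps : R) :
  (forall t, `|t| <= `|k| -> derivable f (p + t *: v) v /\
     `|'D_v f (p + t *: v) - D| <= eps) ->
  `|f (p + k *: v) - f p - k * D| <= eps * `|k|.
Proof.
move=> h.
pose phi (t : R) := f (p + t *: v).
have dphi t : `|t| <= `|k| -> is_derive t (1 : R) phi ('D_v f (p + t *: v)).
  move=> /h[df _].
  have e : (fun h : R => h^-1 *: (phi (h *: (1 : R) + t) - phi t)) =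
      (fun h : R => h^-1 *: (f (h *: v + (p + t *: v)) - f (p + t *: v))).
    apply/funext => a; rewrite /phi; congr (_ *: (f _ - _)).
    by rewrite [a%:A]mulr1 scalerDl addrCA.
  by split; [rewrite /derivable e; exact: df|rewrite /derive e].
suff [t tk E] : exists2 t, `|t| <= `|k| & phi k - phi 0 = 'D_v f (p + t *: v) * k.
  have [_ ht] := h t tk.
  move: E; rewrite /phi scale0r addr0 => ->.
  by rewrite mulrC -mulrBr normrM mulrC ler_wpM2r.
have cphi (a b : R) : (forall t, t \in `[a, b] -> `|t| <= `|k|) ->
    {within `[a, b], continuous phi}.
  move=> hab; apply: derivable_within_continuous => t tab.
  by have [] := dphi t (hab t tab).
have W (a b : R) t : t \in `]a, b[ -> t \in `[a, b] by exact: subset_itv_oo_cc.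
have [k0|k0] := leP 0 k.
  have B t : t \in `[0, k] -> `|t| <= `|k|.
    by rewrite in_itv/= => /andP[t0 tk]; rewrite !ger0_norm.
  have [||t tk ->] := @MVT_segment _ phi (fun t => 'D_v f (p + t *: v)) 0 k k0.
  - by move=> t /W/B/dphi.
  - exact: cphi.
  by exists t; [exact: B|rewrite subr0].
have B t : t \in `[k, 0] -> `|t| <= `|k|.
  by rewrite in_itv/= => /andP[kt t0]; rewrite !ler0_norm ?lerN2// ltW.
have [||t tk E] := @MVT_segment _ phi (fun t => 'D_v f (p + t *: v)) k 0 (ltW k0).
- by move=> t /W/B/dphi.
- exact: cphi.
by exists t; [exact: B|rewrite -opprB E sub0r mulrN opprK].
Qed.

Definition frame_der (d : bool) (i : 'I_n) f p : R := 'D_(frame d i p) f p.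

Lemma frame_derE (b : bool) i f :
  frame_der b i f = if b then Xder i f else Yder i f.
Proof. by case: b. Qed.

(** Each side is an integral line of a frame field, along which [f] is
    differentiable with derivative close to its value at [q]; the polygon is short,
    so it stays in the region where this holds. *)
Lemma moves_increment q (r : R) f (eps : R) : 0 < r -> C1H (ccball q r) f -> 0 < eps ->
  exists2 d : R, 0 < d & forall l, cost l < d ->
   `|f (foldl hstep q l) - f q - lsum (fun b i => frame_der b i f q) l| <= eps * cost l.
Proof.
move=> r0 fC1 eps0.
have derC (b : bool) i p : ccball q r p ->
    derivable f p (frame b i p) /\ {for p, continuous (frame_der b i f)}.
  move=> /fC1[_ /(_ i)[dX cX dY cY]]; rewrite frame_derE /frame.
  by case: b; split; [exact: dX|exact: cX|exact: dY|exact: cY].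
have qB : ccball q r q.
  by rewrite /ccball /= (ccdist_refl i0).
have near_q : nbhs q [set p | forall bi : bool * 'I_n,
    `|frame_der bi.1 bi.2 f p - frame_der bi.1 bi.2 f q| <= eps].
  apply: (@filter_forall _ _ (fun (bi : bool * 'I_n) p =>
    `|frame_der bi.1 bi.2 f p - frame_der bi.1 bi.2 f q| <= eps) (nbhs q)) => -[b i] /=.
  have [_ /cvgrPdist_le /(_ _ eps0)] := derC b i q qB.
  by apply: filterS => p; rewrite distrC.
have [d d0 hd] := nbhs_ccdist near_q.
exists (Num.min d r); first by rewrite lt_min d0.
move=> l; rewrite lt_min => /andP[ld lr].
elim/last_ind: l ld lr => [|l st IH] ld lr.
  by rewrite /cost /lsum !big_nil/= subrr subr0 normr0 mulr0.
have costE s' : cost (rcons l s') = cost l + `|s'.2|.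
  by rewrite /cost -cats1 big_cat big_seq1.
rewrite costE in ld lr *.
have {}IH : `|f (foldl hstep q l) - f q - lsum (fun b i => frame_der b i f q) l| <=
    eps * cost l.
  by apply: IH; [apply: le_lt_trans ld|apply: le_lt_trans lr]; rewrite lerDl.
have -> : lsum (fun b i => frame_der b i f q) (rcons l st) =
    lsum (fun b i => frame_der b i f q) l + st.2 * frame_der st.1.1 st.1.2 f q.
  by rewrite /lsum -cats1 big_cat big_seq1.
rewrite foldl_rcons mulrDr; set p := foldl hstep q l in IH *.
rewrite {1}/hstep; set v := frame _ _ p.
have key : `|f (p + st.2 *: v) - f p - st.2 * frame_der st.1.1 st.1.2 f q| <= eps * `|st.2|.
  apply: segment_increment => t tk.
  pose l' := rcons l (st.1, t).
  have pE : p + t *: v = foldl hstep q l' by rewrite foldl_rcons.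
  have vE : v = frame st.1.1 st.1.2 (p + t *: v) by rewrite frame_move.
  have cl : cost l' <= cost l + `|st.2| by rewrite costE lerD2l.
  have ccl := le_trans (ccdist_le (joins_moves q l')) cl; rewrite -pE in ccl.
  have inB : ccball q r (p + t *: v) by exact: le_lt_trans ccl lr.
  have ind : ccdist q (p + t *: v) < d by exact: le_lt_trans ccl ld.
  have [df _] := derC st.1.1 st.1.2 _ inB; rewrite -vE in df.
  by split=> //; have /= := hd _ ind st.1; rewrite {1}/frame_der -vE.
rewrite (_ : _ - _ = (f p - f q - lsum (fun b i => frame_der b i f q) l) +
  (f (p + st.2 *: v) - f p - st.2 * frame_der st.1.1 st.1.2 f q)); last by ring.
by apply: (le_trans (ler_normD _ _)); exact: lerD.
Qed.

(** Differentiability in the sense of Pansu: the polygon of [connect] has length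
    comparable to the distance and the displacement of [p - q], so
    [moves_increment] applies to it. *)
Lemma C1H_differentiable q (r : R) f (eps : R) : 0 < r -> C1H (ccball q r) f -> 0 < eps ->
  exists2 d : R, 0 < d & forall p (eta : R), 0 < eta < d -> ccdist q p <= eta ->
   `|f p - f q - \sum_(i < n) (xc (p - q) i * Xder i f q + yc (p - q) i * Yder i f q)|
     <= eps * eta.
Proof.
move=> r0 fC1 eps0.
pose C : R := @connect_cst R n.
have C0 : 0 < C by exact: connect_cst_gt0.
have [d d0 hd] := moves_increment r0 fC1 (divr_gt0 eps0 C0).
exists (d / C); first exact: divr_gt0.
move=> p eta /andP[eta0]; rewrite ltr_pdivlMr// mulrC => etad qp.
have hz := le_trans (hdist_le_ccdist i0 q p) qp.
have [||||l [lp lc lD]] := @connect R n i0 p q eta.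
- exact: eta0.
- by move=> i; exact: le_trans (coord_le_hnorm _ _ i).1 hz.
- by move=> i; exact: le_trans (coord_le_hnorm _ _ i).2 hz.
- apply: le_trans (vertical_le_ccdist i0 q p) _.
  by rewrite lerXn2r// nnegrE ?ccdist_ge0 ?ltW// (le_lt_trans _ eta0).
have := hd l (le_lt_trans lc etad); rewrite lp lD => h.
apply: (le_trans h); rewrite -mulrA ler_pM2l// mulrC ler_pdivrMr//.
by rewrite mulrC.
Qed.

End Differentiability.

(** * The initial direction of a geodesic leaving the set *)

Section Normal.
Context {R : realType} {n : nat} (i0 : 'I_n).
Implicit Types (p q u v w : heis R n) (f : heis R n -> R) (E : set (heis R n)).

Lemma set_dist_le E p q : E q -> set_dist E p <= ccdist p q.
Proof.
move=> Eq; apply: ge_inf; last by exists q.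
by exists 0 => _ [w _ <-]; exact: ccdist_ge0.
Qed.

Lemma hgrad_norm_gt0 f q : hgrad f q != 0 -> 0 < tnorm q (hgrad f q).
Proof.
move=> h0; rewrite lt_neqAle sqrtr_ge0 andbT eq_sym; apply: contra_neq h0.
rewrite tnorm_hvec => /hnorm_eq0 h.
by rewrite /hgrad big1// => i _; have [-> ->] := h i; rewrite !scale0r addr0.
Qed.

(** In the frame at [gamma 0] the difference quotient has horizontal components
    converging to [A] and [B], and a vertical one of size at most [h]. *)
Lemma cvg_horizontal (gamma : R -> heis R n) (A B : 'I_n -> R) :
  (forall e : R, 0 < e -> \forall h \near 0^'+,
    hnorm (fun i => h^-1 * xc (gamma h - gamma 0) i - A i)
          (fun i => h^-1 * yc (gamma h - gamma 0) i - B i) <= e) ->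
  (\forall h \near 0^'+, `|vertical_part (gamma 0) (gamma h - gamma 0)| <= h ^+ 2) ->
  h^-1 *: (gamma h - gamma 0) @[h --> 0^'+] --> hvec (gamma 0) A B.
Proof.
move=> hhor hver; set q := gamma 0.
have -> : (fun h : R => h^-1 *: (gamma h - q)) = (fun h : R =>
    \sum_(i < n) ((h^-1 * xc (gamma h - q) i) *: X_ i q +
                  (h^-1 * yc (gamma h - q) i) *: Y_ i q) +
    (h^-1 * vertical_part q (gamma h - q)) *: T_ q).
  apply/funext => h; rewrite {1}(frame_decomp q (gamma h - q)) scalerDr scalerA.
  congr (_ + _); rewrite scaler_sumr; apply: eq_bigr => i _.
  by rewrite scalerDr !scalerA.
have -> : hvec q A B = \sum_(i < n) (A i *: X_ i q + B i *: Y_ i q) + 0 *: T_ q.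
  by rewrite scale0r addr0.
apply: cvgD; last first.
  apply: cvgZr_tmp; apply/cvgrPdist_le => e e0; near=> h.
  have h0 : 0 < h by near: h; exact: nbhs_right_gt.
  have he : h <= e by near: h; exact: nbhs_right_le.
  rewrite sub0r normrN normrM gtr0_norm ?invr_gt0// mulrC ler_pdivrMr//.
  have hv : `|vertical_part q (gamma h - q)| <= h ^+ 2 by near: h.
  by rewrite (le_trans hv)// expr2 ler_wpM2r// ltW.
apply: cvg_big => [|i _]; first exact: add_continuous.
apply: cvgD; apply: cvgZr_tmp; apply/cvgrPdist_le => e /hhor; apply: filterS => h he;
  rewrite distrC; apply: le_trans he.
- exact: (coord_le_hnorm (fun i => _ - A i) (fun i => _ - B i) i).1.
- exact: (coord_le_hnorm (fun i => _ - A i) (fun i => _ - B i) i).2.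
Unshelve. all: by end_near. Qed.

End Normal.

Theorem theorem3p15 (R : realType) (n : nat) (n_ge1 : (1 <= n)%N)
  (E : set (heis R n)) (E_closed : closed E)
  (p q : heis R n) (pNE : ~ E p) (qS : boundary E q)
  (dist_pq : set_dist E p = ccdist p q)
  (gamma : R -> heis R n)
  (gamma_geo : minimizing_geodesic gamma (set_dist E p))
  (gamma0 : gamma 0 = q) (gammaL : gamma (set_dist E p) = p)
  (r : R) (f : heis R n -> R) (S_reg : H_regular_with E q r f) :
  h^-1 *: (gamma h - gamma 0) @[h --> 0^'+] --> hnormal f q.
Proof.
pose i0 : 'I_n := Ordinal n_ge1.
case: S_reg => r0 fC1 gradN0 E_f bE_f.
have qB : ccball q r q by rewrite /ccball /= (ccdist_refl i0).
have fq0 : f q = 0 by have : (boundary E `&` ccball q r) q by []; rewrite bE_f => -[].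
have f_gt0 w : ccball q r w -> ~ E w -> 0 < f w.
  move=> wB wNE; rewrite ltNge; apply/negP => fw.
  by have : ([set p | f p <= 0] `&` ccball q r) w by []; rewrite -E_f => -[].
set L := set_dist E p in gamma_geo gammaL dist_pq *.
(* If [L = 0] then [p = gamma 0 = q], which belongs to the closed set [E]. *)
have L0 : 0 < L.
  rewrite lt_neqAle dist_pq (ccdist_ge0 i0) andbT -dist_pq eq_sym.
  apply/eqP => L0; apply: pNE; rewrite -gammaL L0 gamma0.
  by rewrite ((closure_id E).1 E_closed); exact: qS.1.
set N := tnorm q (hgrad f q).
have N0 : 0 < N by apply: hgrad_norm_gt0; exact: gradN0.
pose A i := N^-1 * Xder i f q; pose B i := N^-1 * Yder i f q.
have normAB : hnorm A B = 1.
  rewrite hnormZ gtr0_norm ?invr_gt0// -(tnorm_hvec q).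
  by rewrite mulVf// gt_eqF.
have -> : hnormal f q = hvec (gamma 0) A B.
  rewrite /hnormal -/N gamma0 /hgrad scaler_sumr; apply: eq_bigr => i _.
  by rewrite scalerDr !scalerA.
have geo0 s : 0 < s < L -> ccdist q (gamma s) = s.
  move=> /andP[s0 sL]; rewrite -gamma0 gamma_geo ?lexx ?ltW//.
  by rewrite sub0r normrN gtr0_norm.
have geoL s : 0 < s < L -> ccdist p (gamma s) = L - s.
  move=> /andP[s0 sL]; rewrite -{1}gammaL gamma_geo ?lexx ?ltW//.
  by rewrite gtr0_norm// subr_gt0.
apply: cvg_horizontal => [e e0|]; last first.
  near=> s; rewrite gamma0.
  have s0 : 0 < s by near: s; exact: nbhs_right_gt.
  have sL : s < L by near: s; exact: nbhs_right_lt.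
  rewrite (le_trans (vertical_le_ccdist i0 _ _))// geo0 ?s0//.
(* The square of the final error is below [4 * eps]; [eps < 1] keeps [sigma] positive. *)
pose eps := Num.min (e ^+ 2 / 4) (1 / 2).
have eps0 : 0 < eps by rewrite lt_min !divr_gt0// exprn_gt0.
have eps1 : eps < 1 by rewrite gt_min; apply/orP; right; lra.
have epse : 4 * eps <= e ^+ 2 by rewrite mulrC -ler_pdivlMr// ge_min lexx.
(* The expansion is used at distance at most [2 * s] with relative error
   [eps * N / 2], which makes the error in [f w] at most [N * eps * s]. *)
have [d d0 hd] :=
  C1H_differentiable i0 r0 fC1 (divr_gt0 (mulr_gt0 eps0 N0) (ltr0n R 2)).
near=> s.
have s0 : 0 < s by near: s; exact: nbhs_right_gt.
have sL : s < L by near: s; exact: nbhs_right_lt.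
have sd : 2 * s < d.
  rewrite mulrC -ltr_pdivlMr//; near: s;
  by apply: nbhs_right_lt; exact: divr_gt0.
have sr : 2 * s < r.
  rewrite mulrC -ltr_pdivlMr//; near: s;
  by apply: nbhs_right_lt; exact: divr_gt0.
have sI : 0 < s < L by rewrite s0.
rewrite gamma0.
pose sigma := (1 - eps) * s.
have sigma0 : 0 < sigma by rewrite mulr_gt0// subr_gt0.
have sigmas : sigma < s by rewrite gtr_pMl// gtrBl.
pose v := - sigma *: hvec (gamma s) A B.
have hv : horizontal (gamma s) v by apply: horizontalZ; exact: horizontal_hvec.
have nv : tnorm (gamma s) v = sigma.
  by rewrite tnormZ ?tnorm_hvec ?normAB ?mulr1 ?normrN ?gtr0_norm//; exact: horizontal_hvec.
(* The end point of the backward segment, too close to [p] to be in [E]. *)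
pose w := gamma s + v.
have wNE : ~ E w.
  move=> Ew; have := set_dist_le i0 p Ew; rewrite -/L.
  apply/negP; rewrite -ltNge (le_lt_trans (ccdist_extend i0 p hv))// geoL// nv.
  by lra.
have qw : ccdist q w <= 2 * s.
  rewrite (le_trans (ccdist_extend i0 q hv))// geo0// nv; lra.
have fw : 0 < f w by apply: f_gt0 => //; exact: le_lt_trans qw sr.
have := hd w (2 * s) (introT andP (conj (mulr_gt0 (ltr0n R 2) s0) sd)) qw.
set x := xc (gamma s - q); set y := yc (gamma s - q).
rewrite fq0 subr0.
have -> : \sum_(i < n) (xc (w - q) i * Xder i f q + yc (w - q) i * Yder i f q) =
    N * (\sum_(i < n) (x i * A i + y i * B i) - sigma).
  have S1 : \sum_(i < n) (A i ^+ 2 + B i ^+ 2) = 1 by rewrite -sqr_hnorm normAB expr1n.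
  rewrite -[sigma]mulr1 -S1 mulr_sumr -sumrB mulr_sumr; apply: eq_bigr => i _.
  have -> : xc (w - q) i = x i - sigma * A i.
    by rewrite /w /v /x addrAC [LHS]xcD xcZ xc_hvec mulNr.
  have -> : yc (w - q) i = y i - sigma * B i.
    by rewrite /w /v /y addrAC [LHS]ycD ycZ yc_hvec mulNr.
  have -> : Xder i f q = N * A i by rewrite /A mulrA mulfV ?mul1r// gt_eqF.
  have -> : Yder i f q = N * B i by rewrite /B mulrA mulfV ?mul1r// gt_eqF.
  by ring.
set S := \sum_(i < n) _ => /ler_normlW h.
have hS : (1 - 2 * eps) * s < S.
  have : f w <= N * (S - sigma + eps * s) by lra.
  move=> /(lt_le_trans fw); rewrite pmulr_rgt0// /sigma; lra.
have xs : hnorm x y <= s by rewrite -[leRHS](geo0 s sI); exact: hdist_le_ccdist.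
have -> : (fun i => s^-1 * x i - A i) = (fun i => s^-1 * (x i - s * A i)).
  by apply/funext => i; rewrite mulrBr mulKf// gt_eqF.
have -> : (fun i => s^-1 * y i - B i) = (fun i => s^-1 * (y i - s * B i)).
  by apply/funext => i; rewrite mulrBr mulKf// gt_eqF.
rewrite hnormZ gtr0_norm ?invr_gt0// mulrC ler_pdivrMr//.
rewrite -ler_sqr ?nnegrE ?hnorm_ge0 ?mulr_ge0 ?ltW// sqr_hnorm.
have -> : \sum_(i < n) ((x i - s * A i) ^+ 2 + (y i - s * B i) ^+ 2) =
    hnorm x y ^+ 2 - 2 * s * S + s ^+ 2 * hnorm A B ^+ 2.
  rewrite !sqr_hnorm /S !mulr_sumr -sumrB -big_split/=.
  by apply: eq_bigr => i _; ring.
(* [|z - s nu|^2 <= s^2 - 2 s <z, nu> + s^2 < 4 eps s^2]. *)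
rewrite normAB expr1n mulr1 exprMn.
have : hnorm x y ^+ 2 <= s ^+ 2 by rewrite lerXn2r// nnegrE ?hnorm_ge0 ?ltW.
move: hS epse s0; rewrite !expr2; nra.
Unshelve. all: by end_near. Qed.
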